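(* Let $1\le p\le\infty$ and $E=\mathcal{L}^p(I)$. For any $\Lambda<1$, the operator $I-\mathcal{P}_0^1:E\to E$, $b\mapsto b-0*_Tb$, is injective and has closed range (here $I$ denotes the identity operator on $E$).
   Context: Let $N\ge 2$, $[x_0,x_N]$ be the interval (also denoted $I$ in $\mathcal{L}^p(I)$), $\Delta: x_0<\dots<x_N$ a partition, $L_n(x)=a_nx+b_n$ affine with $L_n(x_0)=x_{n-1}$, $L_n(x_N)=x_n$, $I_1=[x_0,x_1]$, $I_n=(x_{n-1},x_n]$ for $n\ge2$, and $\alpha=(\alpha_1,\dots,\alpha_N)\in(\mathcal{L}^\infty)^N$ with $\Lambda:=\operatorname{ess\,sup}\{|\alpha_n(x)|\}<1$. For $f,b\in E$, $f*_Tb$ is the unique fixed point in $E$ of the contraction $Tg(x):=f(x)+\alpha_n(L_n^{-1}(x))(g-b)(L_n^{-1}(x))$, $x\in I_n$; $0$ is the null function and $\mathcal{P}_0^1(b):=0*_Tb$. *)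

(* Defs.v *)
From HB Require Import structures.
From mathcomp Require Import all_boot all_order all_algebra.
From mathcomp Require Import all_classical all_reals all_analysis ess_sup_inf.
Set Implicit Arguments. Unset Strict Implicit. Unset Printing Implicit Defensive.
Import Order.TTheory GRing.Theory Num.Theory.
Import numFieldNormedType.Exports.
Local Open Scope classical_set_scope.
Local Open Scope ring_scope.

Section defs.
Context {R : realType}.

Definition Iint (x : nat -> R) (N : nat) : set R := `[x 0%N, x N].

Lemma Iint_measurable (x : nat -> R) (N : nat) : measurable (Iint x N).
Proof. exact: measurable_itv. Qed.

(* Lebesgue measure restricted to I: L^p(I) is modelled by functions R -> R,
   with norms/a.e. taken w.r.t. this measure (values outside I are irrelevant). *)
Definition muI (x : nat -> R) (N : nat) :=
  mrestr (@lebesgue_measure R) (Iint_measurable x N).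

Definition inLp (x : nat -> R) (N : nat) (p : \bar R) (f : R -> R) : Prop :=
  measurable_fun (Iint x N) f /\ finite_norm (muI x N) p f.

Definition aeqI (x : nat -> R) (N : nat) (f g : R -> R) : Prop :=
  {ae muI x N, forall y, f y = g y}.

Definition Ipiece (x : nat -> R) (n : nat) : set R :=
  if n == 1%N then `[x 0%N, x 1%N]%classic else `]x n.-1, x n]%classic.

(* L_n (t) = a_n t + b_n, with L_n(x_0) = x_{n-1}, L_n(x_N) = x_n *)
Definition Lmap (x : nat -> R) (N n : nat) (t : R) : R :=
  x n.-1 + (t - x 0%N) * ((x n - x n.-1) / (x N - x 0%N)).

Definition Linv (x : nat -> R) (N n : nat) (y : R) : R :=
  x 0%N + (y - x n.-1) * ((x N - x 0%N) / (x n - x n.-1)).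

(* T g (y) = f y + alpha_n (L_n^{-1} y) (g - b)(L_n^{-1} y) for y in I_n
   (the pieces I_n are disjoint, so the sum has exactly one nonzero term
   on I; outside I the value is irrelevant). *)
Definition Top (x : nat -> R) (N : nat) (alpha : nat -> R -> R)
    (f b g : R -> R) : R -> R :=
  fun y => f y + \sum_(1 <= n < N.+1)
    \1_(Ipiece x n) y * (alpha n (Linv x N n y) *
                          (g (Linv x N n y) - b (Linv x N n y))).

Definition is_fixT (x : nat -> R) (N : nat) (p : \bar R) (alpha : nat -> R -> R)
    (f b g : R -> R) : Prop :=
  inLp x N p g /\ aeqI x N (Top x N alpha f b g) g.

(* f *_T b : the (unique in E) fixed point of T *)
Definition starT (x : nat -> R) (N : nat) (p : \bar R) (alpha : nat -> R -> R)
    (f b : R -> R) : R -> R :=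
  match pselect (exists g, is_fixT x N p alpha f b g) with
  | left H => projT1 (cid H)
  | right _ => (fun _ => 0)
  end.

Definition P01 (x : nat -> R) (N : nat) (p : \bar R) (alpha : nat -> R -> R)
    (b : R -> R) : R -> R :=
  starT x N p alpha (fun _ => 0) b.

Definition Lambda (x : nat -> R) (N : nat) (alpha : nat -> R -> R) : \bar R :=
  ess_sup (muI x N) (fun y => (\big[Num.max/0]_(1 <= n < N.+1) `|alpha n y|)%:E).

End defs.

(* Main.v *)
Require Import Defs.
From HB Require Import structures.
From mathcomp Require Import all_boot all_order all_algebra.
From mathcomp Require Import all_classical all_reals all_analysis ess_sup_inf.
From mathcomp Require Import measurable_realfun ring.
Import Order.TTheory GRing.Theory Num.Theory.
Import numFieldNormedType.Exports.
Local Open Scope classical_set_scope.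
Local Open Scope ring_scope.

(** Let [tau] be the expanding map equal to [L_n^-1] on [I_n], let [A = alpha_n o L_n^-1]
    on [I_n], and put [S u = A . (u o tau)].  The fixed point equation of [g = 0 *_T b]
    reads [g = S (g - b)], so that [h := b - g] satisfies [b = h - S h]: thus [I - P_0^1]
    is a bijection of [E] with inverse [I - S], and its range is all of [E].

    Since the slopes of the [L_n] add up to 1, [tau] preserves the Lebesgue measure
    of [I], hence [S] maps [L^p] to itself.  Existence of the fixed point follows from the
    a.e. convergence of the Neumann series [sum_k S^k f], dominated by a function of [L^p];
    uniqueness from the contraction estimate in [L^1]. *)

(** * Membership in [L^p], for finite [p] and for [p = +oo] *)

Section Lfun_facts.
Set Implicit Arguments.
Unset Strict Implicit.
Context d (T : measurableType d) (R : realType).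
Variable mu : {measure set T -> \bar R}.

Lemma Lfun_EFinP (p : R) (f : T -> R) : 1 <= p ->
  f \in Lfun mu p%:E <->
  measurable_fun setT f /\ (\int[mu]_y (`|f y| `^ p)%:E < +oo)%E.
Proof.
move=> p1; have p0 : p^-1 != 0 by rewrite invr_neq0// gt_eqF// (lt_le_trans ltr01).
have E : Lnorm mu p%:E (EFin \o f) = ((\int[mu]_y (`|f y| `^ p)%:E) `^ p^-1)%E.
  by rewrite unlock.
split.
  move=> /andP[]; rewrite !inE/= => mf.
  by rewrite /finite_norm E => /(lty_poweRy p0).
move=> [mf fy]; apply/andP; rewrite !inE/=; split => //.
by rewrite /finite_norm E poweR_lty.
Qed.

Lemma Lfun_pinftyP (f : T -> R) :
  f \in Lfun mu +oo%E <->
  measurable_fun setT f /\ exists M, {ae mu, forall y, `|f y| <= M}.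
Proof.
have E : Lnorm mu +oo%E (EFin \o f) =
    if (0 < mu setT)%E then ess_sup mu (EFin \o (Num.norm \o f)) else 0%E.
  by rewrite unlock.
split.
  move=> /andP[]; rewrite !inE/= => mf; rewrite /finite_norm E => fy; split => //.
  move: fy; case: ifPn => [_ /ess_supr_bounded//|].
  (* For the zero measure the norm is 0 by convention whatever [f] is, but then every bound holds
     almost everywhere. *)
  rewrite -leNgt => mu0 _; exists 0; apply: measure0_ae.
  by apply/eqP; rewrite eq_le mu0/=.
move=> [mf [M fM]]; apply/andP; rewrite !inE/=; split => //.
rewrite /finite_norm E; case: ifPn => // _.
apply: (@le_lt_trans _ _ M%:E); last exact: ltry.
by apply/ess_supP; apply: filterS fM => y; rewrite /= lee_fin.
Qed.

Lemma Lfun_measurable (p : \bar R) (f : T -> R) :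
  f \in Lfun mu p -> measurable_fun setT f.
Proof. by move=> /andP[]; rewrite !inE/=. Qed.

Lemma measurable_norm_powR (p : R) (f : T -> R) : measurable_fun setT f ->
  measurable_fun setT (fun y => (`|f y| `^ p)%:E).
Proof.
move=> mf; apply/measurable_EFinP.
apply: (@measurableT_comp _ _ _ _ _ _ (@powR R ^~ p)) => //.
exact: measurableT_comp.
Qed.

Lemma Lfun_le (p : \bar R) (f g : T -> R) : (1 <= p)%E ->
  measurable_fun setT f -> g \in Lfun mu p ->
  {ae mu, forall y, `|f y| <= `|g y|} -> f \in Lfun mu p.
Proof.
case: p => [p|_|//]; last first.
  move=> mf /Lfun_pinftyP[mg [M gM]] fg; apply/Lfun_pinftyP; split => //.
  by exists M; apply: filterS2 fg gM => y /le_trans; apply.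
rewrite lee_fin => p1 mf /(Lfun_EFinP _ p1)[mg gy] fg; apply/(Lfun_EFinP _ p1).
split => //; apply: le_lt_trans gy; apply: ae_ge0_le_integral => //.
- exact: measurable_norm_powR.
- exact: measurable_norm_powR.
- apply: filterS fg => y fgy _; rewrite lee_fin ge0_ler_powR ?nnegrE//.
  exact: le_trans p1.
Qed.

Lemma Lfun_scalel (p : \bar R) (c : R) (f : T -> R) : (1 <= p)%E ->
  f \in Lfun mu p -> (fun y => c * f y) \in Lfun mu p.
Proof.
move=> p1 fp; have [f0 /(_ c f 0 fp f0)] := Lfun_submod_closed mu p1.
by rewrite addr0.
Qed.

End Lfun_facts.

(** * Measure-preserving maps [tau] and the equation [h = f + A . (h o tau)] *)

Section measure_preserving.
Set Implicit Arguments.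
Unset Strict Implicit.
Context d (T : measurableType d) (R : realType).
Variables (mu : {measure set T -> \bar R}) (tau : T -> T).
Hypothesis mtau : measurable_fun setT tau.
Hypothesis tauK : forall B, measurable B -> mu (tau @^-1` B) = mu B.

Lemma ae_comp (P : T -> Prop) :
  {ae mu, forall y, P y} -> {ae mu, forall y, P (tau y)}.
Proof.
move=> [B [mB B0 PB]]; exists (tau @^-1` B); split.
- by rewrite -[_ @^-1` _]setTI; exact: mtau.
- by rewrite -B0; exact: tauK.
- by move=> y /= Py; exact: PB.
Qed.

Lemma ae_comp_iter (P : T -> Prop) k :
  {ae mu, forall y, P y} -> {ae mu, forall y, P (iter k tau y)}.
Proof.
elim: k P => // k IH P aeP.
by apply: (IH (fun y => P (tau y))); exact: ae_comp.
Qed.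

Lemma measurable_iter k : measurable_fun setT (iter k tau).
Proof.
elim: k => [|k IH]; first exact: measurable_id.
exact: (measurableT_comp mtau IH).
Qed.

Lemma ge0_integral_comp (f : T -> \bar R) : measurable_fun setT f ->
  (forall y, 0 <= f y)%E -> (\int[mu]_y f (tau y) = \int[mu]_y f y)%E.
Proof.
move=> mf f0.
have := @ge0_integral_pushforward _ _ _ _ R _ mtau mu setT f measurableT mf
  (fun y _ => f0 y).
rewrite preimage_setT => <-.
by apply: eq_measure_integral => B mB _; exact: tauK.
Qed.

Lemma ge0_integral_comp_iter (f : T -> \bar R) k : measurable_fun setT f ->
  (forall y, 0 <= f y)%E -> (\int[mu]_y f (iter k tau y) = \int[mu]_y f y)%E.
Proof.
move=> mf f0; elim: k => // k IH; rewrite -[RHS]IH; under eq_integral do rewrite iterSr.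
apply: (@ge0_integral_comp (fun y => f (iter k tau y))) => //.
exact: measurableT_comp (measurable_iter k).
Qed.

Lemma Lfun_comp (p : \bar R) (f : T -> R) : (1 <= p)%E ->
  f \in Lfun mu p -> f \o tau \in Lfun mu p.
Proof.
case: p => [p|_|//]; last first.
  move=> /Lfun_pinftyP[mf [M fM]]; apply/Lfun_pinftyP; split.
    exact: measurableT_comp.
  by exists M; exact: (@ae_comp (fun y => `|f y| <= M)).
rewrite lee_fin => p1 /(Lfun_EFinP _ _ p1)[mf fy]; apply/(Lfun_EFinP _ _ p1).
split; first exact: measurableT_comp.
rewrite (@ge0_integral_comp (fun y => (`|f y| `^ p)%:E))//.
exact: measurable_norm_powR.
Qed.

(* For finite [p] the majorant comes from the weighted sum
   [H = sum_k r^k |f o tau^k|^p], whose integral is [|f|_p^p / (1 - r)]: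
   since [p >= 1], [(r^k |f o tau^k|)^p <= r^k |f o tau^k|^p <= H]. *)
Lemma Lfun_iter_majorant (p : \bar R) (r : R) (f : T -> R) : (1 <= p)%E ->
  0 < r < 1 -> f \in Lfun mu p ->
  exists2 K, K \in Lfun mu p &
    {ae mu, forall y, forall k, r ^+ k * `|f (iter k tau y)| <= `|K y|}.
Proof.
case: p => [p|_ /andP[r0 r1]|//]; last first.
  move=> /Lfun_pinftyP[mf [M fM]].
  (* For [p = +oo] an essential bound of [f] dominates every term, since [r ^+ k <= 1]. *)
  exists (cst M).
    apply/Lfun_pinftyP; split; first exact: measurable_cst.
    by exists `|M|; apply: aeW.
  apply: ae_foralln => k; apply: filterS (ae_comp_iter k fM) => y yM.
  apply: (@le_trans _ _ `|f (iter k tau y)|).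
    by rewrite ler_piMl// exprn_ile1// ltW.
  by rewrite (le_trans yM)// ler_norm.
rewrite lee_fin => p1 /andP[r0 r1] /(Lfun_EFinP _ _ p1)[mf fy].
have p0 : 0 < p by exact: lt_le_trans p1.
pose F k y : \bar R := (r ^+ k * `|f (iter k tau y)| `^ p)%:E.
have F0 k y : (0 <= F k y)%E by rewrite lee_fin mulr_ge0 ?exprn_ge0 ?powR_ge0// ltW.
have mf' : measurable_fun setT (fun y => (`|f y| `^ p)%:E).
  exact: measurable_norm_powR.
have mFk k : measurable_fun setT (fun y => (`|f (iter k tau y)| `^ p)%:E).
  exact: (measurableT_comp mf' (measurable_iter k)).
have mF k : measurable_fun setT (F k).
  by rewrite /F; under eq_fun do rewrite EFinM; exact: measurable_funeM.
pose H y := (\sum_(k <oo) F k y)%E.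
have H0 y : (0 <= H y)%E by exact: nneseries_ge0.
have mH : measurable_fun setT H.
  by apply: ge0_emeasurable_sum => // k y _ _; exact: F0.
have IH : (\int[mu]_y H y < +oo)%E.
  rewrite integral_nneseries//.
  set C := (\int[mu]_y _)%E in fy.
  have C0 : (0 <= C)%E by apply: integral_ge0 => y _; rewrite lee_fin powR_ge0.
  have IF k : (\int[mu]_y F k y = (r ^+ k)%:E * C)%E.
    rewrite /F; under eq_integral do rewrite EFinM.
    rewrite ge0_integralZl_EFin ?exprn_ge0 ?(ltW r0)//.
    by rewrite (@ge0_integral_comp_iter (fun y => (`|f y| `^ p)%:E)).
  have Cfin : C \is a fin_num by rewrite ge0_fin_numE.
  rewrite (eq_eseriesr (fun k _ => IF k)) -(fineK Cfin).
  apply: (@le_lt_trans _ _ (fine C * (1 - r)^-1)%:E); last exact: ltry.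
  apply: lime_le.
    apply: is_cvg_nneseries => n _ _.
    by rewrite -EFinM lee_fin mulr_ge0 ?exprn_ge0 ?fine_ge0// ltW.
  apply: nearW => n; under eq_bigr do rewrite -EFinM mulrC.
  by rewrite sumEFin lee_fin geometric_le_lim ?fine_ge0// ger0_norm// ltW.
(* [fine] sends [+oo] to 0, so the majorant built below is only meaningful where [H] is finite;
   integrability makes this almost everywhere. *)
have Hfin : {ae mu, forall y, H y \is a fin_num}.
  have : mu.-integrable setT H.
    apply/integrableP; split => //.
    by under eq_integral do rewrite gee0_abs//.
  by move=> /(integrable_ae measurableT); apply: filterS => y /(_ I).
pose K y := (fine (H y)) `^ p^-1.
exists K.
  apply/(Lfun_EFinP _ _ p1); split.
    apply: (@measurableT_comp _ _ _ _ _ _ (@powR R ^~ p^-1)) => //.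
    exact: measurableT_comp.
  apply: le_lt_trans IH; apply: ae_ge0_le_integral => //.
  - apply: measurable_norm_powR.
    apply: (@measurableT_comp _ _ _ _ _ _ (@powR R ^~ p^-1)) => //.
    exact: measurableT_comp.
  - apply: filterS Hfin => y Hy _.
    rewrite /K ger0_norm ?powR_ge0// -powRrM mulVf ?gt_eqF// powRr1 ?fineK//.
    by rewrite fine_ge0.
apply: filterS Hfin => y Hy k.
rewrite /K [leRHS]ger0_norm ?powR_ge0//.
have FH : (F k y <= H y)%E.
  apply: le_trans (nneseries_lim_ge k.+1 (fun n _ _ => F0 n y)).
  by rewrite big_nat_recr//= leeDr// sume_ge0.
rewrite -[leLHS](@powRr1 R) ?mulr_ge0 ?exprn_ge0 ?(ltW r0)//.
rewrite -(@mulfV _ p) ?gt_eqF// powRrM ge0_ler_powR ?nnegrE ?powR_ge0 ?fine_ge0//.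
  by rewrite invr_ge0 ltW.
rewrite -lee_fin fineK//; apply: le_trans FH.
rewrite lee_fin powRM ?exprn_ge0 ?(ltW r0)// ler_wpM2r ?powR_ge0//.
by rewrite ge1r_powR// exprn_gt0// exprn_ile1// ltW.
Qed.

(** The [k]-th Neumann term carries a factor at most [(r ^+ 2) ^+ k], which is split in two: one
    [r ^+ k] is absorbed with [f o tau^k] into the majorant [K], the other gives geometric
    convergence and the bound [|h| <= |K| / (1 - r)]. *)
Lemma Lfun_affine_fixpoint (p : \bar R) (r : R) (A f : T -> R) : (1 <= p)%E ->
  0 < r < 1 -> measurable_fun setT A -> {ae mu, forall y, `|A y| <= r ^+ 2} ->
  f \in Lfun mu p ->
  exists2 h, h \in Lfun mu p & {ae mu, forall y, h y = f y + A y * h (tau y)}.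
Proof.
move=> p1 r01 mA Ar fp; have mf := Lfun_measurable fp.
have [K Kp fK] := Lfun_iter_majorant p1 r01 fp.
have /andP[r0 r1] := r01.
pose t y k := (\prod_(j < k) A (iter j tau y)) * f (iter k tau y).
pose s y := series (t y).
(* An upper limit is defined and measurable everywhere; at good points it is the actual sum of the
   series. *)
pose h y := fine (limn_esup (EFin \o s y)).
(* The bounds must hold along the whole orbit of [y]. This excludes only countably many null sets,
   because iterates of [tau] pull null sets back to null sets. *)
pose good y := (forall j, `|A (iter j tau y)| <= r ^+ 2) /\
  forall k, r ^+ k * `|f (iter k tau y)| <= `|K y|.
have aegood : {ae mu, forall y, good y}.
  apply: filterS2 fK; last exact: (ae_foralln (fun k => ae_comp_iter k Ar)).
  by move=> y; split.
have t_le y k : good y -> `|t y k| <= geometric `|K y| r k.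
  move=> [Ay fy]; rewrite /t normrM normr_prod /=.
  apply: (@le_trans _ _ (r ^+ 2 ^+ k * `|f (iter k tau y)|)).
    rewrite ler_wpM2r// -[k in leRHS]card_ord -prodr_const.
    by apply: ler_prod => j _; rewrite normr_ge0 Ay.
  rewrite exprAC expr2 -mulrA mulrC ler_wpM2r// exprn_ge0//.
  exact: ltW.
have cvg_s y : good y -> s y @ \oo --> h y.
  move=> gy; have cs : cvgn (s y).
    apply: normed_cvg; apply: series_le_cvg (t_le y ^~ gy) _ => //.
      by move=> n; rewrite geometric_ge0// ltW.
    by apply: is_cvg_geometric_series; rewrite ger0_norm// ltW.
  rewrite /h is_cvg_limn_esupE ?EFin_lim//.
  by apply: (cvg_comp _ _ cs).
have h_le y : good y -> `|h y| <= (1 - r)^-1 * `|K y|.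
  move=> gy; rewrite mulrC.
  apply: (cvgr_to_le (cvg_norm (cvg_s y gy))); apply: nearW => n.
  apply: le_trans (ler_norm_sum _ _ _) _.
  apply: le_trans (geometric_le_lim n _ r0 _) => //; last by rewrite ger0_norm// ltW.
  by apply: ler_sum => k _; exact: t_le.
have s_rec y n : s y n.+1 = f y + A y * s (tau y) n.
  rewrite /s /series/= big_nat_recl//= /t big_ord0 mul1r mulr_sumr; congr (_ + _).
  apply: eq_bigr => k _; rewrite big_ord_recl mulrA -iterSr; congr (_ * _ * _).
  by apply: eq_bigr => j _; rewrite -iterSr.
have ms n : measurable_fun setT (fun y => s y n).
  rewrite /s /series/=; apply: measurable_sum => k; apply: measurable_funM.
    by apply: measurable_prod => j _; exact: (measurableT_comp mA (measurable_iter j)).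
  exact: (measurableT_comp mf (measurable_iter k)).
exists h.
  apply: (@Lfun_le _ _ _ _ _ _ (fun y => (1 - r)^-1 * K y)) => //.
  - apply: measurableT_comp => //; apply: measurable_fun_limn_esup => n.
    exact/measurable_EFinP.
  - exact: Lfun_scalel.
  - apply: filterS aegood => y gy; rewrite (le_trans (h_le _ gy))// normrM.
    by rewrite ger0_norm// invr_ge0 subr_ge0 ltW.
(* The recurrence [s_rec] is passed to the limit on both sides, which requires convergence at [y]
   and at [tau y]. *)
apply: filterS2 aegood (ae_comp aegood) => y gy gty.
have c1 : (fun n => s y n.+1) @ \oo --> h y by rewrite (cvg_shiftS (s y)); exact: cvg_s.
have c2 : (fun n => s y n.+1) @ \oo --> f y + A y * h (tau y).
  under eq_fun do rewrite s_rec.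
  by apply: cvgD; [exact: cvg_cst|apply: cvgM; [exact: cvg_cst|exact: cvg_s]].
by rewrite -(cvg_lim _ c1)// -(cvg_lim _ c2).
Qed.

(** Finite measure embeds [L^p] in [L^1], so one argument serves all [p]: integrating the inequality
    and using invariance under [tau] gives [I <= q * I] for the finite integral [I] of [|u|], hence
    [I = 0]. *)
Lemma Lfun_linear_fixpoint_eq0 (p : \bar R) (q : R) (u : T -> R) : (1 <= p)%E ->
  mu setT \is a fin_num -> 0 <= q < 1 -> u \in Lfun mu p ->
  {ae mu, forall y, `|u y| <= q * `|u (tau y)|} ->
  {ae mu, forall y, u y = 0}.
Proof.
move=> p1 mufin /andP[q0 q1] up uq.
have /Lfun1_integrable/integrableP[mu' iu] := Lfun_subset (lexx (1%E : \bar R)) p1 mufin p1 up.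
have mau : measurable_fun setT (fun y => `|(u y)%:E|%E) by exact: measurableT_comp.
set I := (\int[mu]_y _)%E in iu.
have I0 : (0 <= I)%E by exact: integral_ge0.
have Ifin : I \is a fin_num by rewrite ge0_fin_numE.
have mau' := measurableT_comp mau mtau.
have IE : I = (\int[mu]_y `|(u (tau y))%:E|)%E by rewrite (ge0_integral_comp mau).
have : (I <= q%:E * I)%E.
  rewrite [in leRHS]IE -ge0_integralZl_EFin//.
  apply: ae_ge0_le_integral => //.
  - by move=> y _; rewrite -EFinM lee_fin mulr_ge0.
  - exact: measurable_funeM.
  - by apply: filterS uq => y uy _; rewrite /= -EFinM lee_fin.
rewrite -(fineK Ifin) -EFinM lee_fin => Iq.
have I00 : I = 0%E.
  rewrite -(fineK Ifin); congr EFin; apply/eqP; rewrite eq_le fine_ge0// andbT.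
  by rewrite leNgt; apply/negP => Ipos; move: Iq; rewrite leNgt gtr_pMl// q1.
have /ae_eq_integral_abs := I00 => /(_ measurableT mu').
by apply: filterS => y /(_ Logic.I)[].
Qed.

End measure_preserving.

(** * Lebesgue measure under increasing affine maps *)

Section Lebesgue_affine.
Set Implicit Arguments.
Unset Strict Implicit.
Context (R : realType).

Lemma measurable_affine (a b c : R) : measurable_fun setT (fun y : R => a + (y - b) * c).
Proof.
by apply: measurable_funD => //; apply: measurable_funM => //; exact: measurable_funB.
Qed.

Lemma lebesgue_measure_affine_preimage (a b c : R) (B : set R) : 0 < c ->
  measurable B ->
  lebesgue_measure ((fun y : R => a + (y - b) * c) @^-1` B) = (c^-1%:E * lebesgue_measure B)%E.
Proof.
move=> c0 mB.
pose nc := NngNum (ltW c0).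
pose phi : measurableTypeR R -> measurableTypeR R := fun y => a + (y - b) * c.
have mphi : measurable_fun setT phi := measurable_affine a b c.
(* The image of Lebesgue measure under [phi], multiplied by [c], gives []u, v]] its length;
   uniqueness of Lebesgue measure then settles all measurable sets. *)
have -> : lebesgue_measure B =
    mscale nc (pushforward (@lebesgue_measure R) phi) B.
  move=> mphi'; apply: lebesgue_measure_unique => // _ [[u v]] _ <- /=.
  rewrite /mscale/= /pushforward.
  have -> : phi @^-1` `]u, v] = `](u - a) / c + b, (v - a) / c + b]%classic.
    apply/seteqP; split => y; rewrite /= !in_itv/= /phi;
      by rewrite -ltrBrDr ltr_pdivrMr// -lerBlDr ler_pdivlMr// ltrBlDl lerBrDl.
  rewrite !lebesgue_measure_itv/= !lte_fin ltrD2r ltr_pM2r ?invr_gt0// ltrD2r.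
  case: ifP => uv; last by rewrite mule0.
  rewrite -!EFinD -EFinM; congr EFin.
  by field; rewrite gt_eqF.
by rewrite /mscale/= /pushforward muleA -EFinM mulVf ?mul1e// gt_eqF.
Qed.

End Lebesgue_affine.

(** * The pieces [I_n] and the expanding map glued from the inverse branches *)

Section partition.
Set Implicit Arguments.
Unset Strict Implicit.
Context (R : realType) (N : nat) (x : nat -> R).
Hypothesis N2 : (2 <= N)%N.
Hypothesis xlt : forall i j : nat, (i < j <= N)%N -> x i < x j.

Lemma Ipiece_cover (y : R) : Iint x N y ->
  exists2 n, (1 <= n <= N)%N & Ipiece x n y.
Proof.
rewrite /Iint/= in_itv/= => /andP[y0 yN].
have N0 : (0 < N)%N by exact: leq_trans N2.
have ex : exists n, (0 < n)%N && (y <= x n) by exists N; rewrite N0.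
(* The piece containing [y] has the least positive index [n] with [y <= x n]; for [n >= 2],
   minimality gives [x n.-1 < y]. *)
case: (ex_minnP ex) => n /andP[n0 yn] nmin; exists n.
  by rewrite n0 nmin// N0.
rewrite /Ipiece; case: ifPn => [/eqP n1|n1]; rewrite /= in_itv/=.
  by rewrite y0 -n1.
rewrite yn andbT ltNge; apply/negP => yn1.
case: n n0 n1 yn1 nmin {yn} => [|[|n]]//= _ _ yn1 /(_ n.+1).
by rewrite yn1 ltnn => /(_ isT).
Qed.

Lemma Ipiece_inj (y : R) m n : (1 <= m <= N)%N -> (1 <= n <= N)%N ->
  Ipiece x m y -> Ipiece x n y -> m = n.
Proof.
wlog mn : m n / (m < n)%N => [H|/andP[m0 mN] /andP[n0 nN]].
  move=> mN nN my ny; have [mn|nm|//] := ltngtP m n; first exact: H.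
  by apply/esym; exact: H.
move=> my; rewrite /Ipiece gtn_eqF ?(leq_trans _ mn)//= in_itv/= => /andP[+ _].
have {my} ym : y <= x m.
  by move: my; rewrite /Ipiece; case: ifPn => [/eqP->|_]; rewrite /= in_itv/= => /andP[].
rewrite ltNge (le_trans ym)//.
case: n mn n0 nN => // n; rewrite ltnS leq_eqVlt => /orP[/eqP->//|mn] _ nN /=.
by apply/ltW/xlt; rewrite mn ltnW.
Qed.

Lemma sum_Ipiece (F : nat -> R) (y : R) n : (1 <= n <= N)%N -> Ipiece x n y ->
  \sum_(1 <= m < N.+1) \1_(Ipiece x m) y * F m = F n.
Proof.
move=> nN ny; rewrite (bigD1_seq n)/=; last 2 first.
- by rewrite mem_index_iota.
- exact: iota_uniq.
rewrite indicE mem_set// mul1r big_seq_cond big1 ?addr0// => m.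
rewrite mem_index_iota => /andP[mN mn]; rewrite indicE memNset ?mul0r// => my.
by move/eqP: mn; apply; exact: (Ipiece_inj mN nN my ny).
Qed.

Lemma measurable_Ipiece n : measurable (Ipiece x n).
Proof. by rewrite /Ipiece; case: ifPn => _; exact: measurable_itv. Qed.

Lemma Linv_Ipiece (y : R) n : (1 <= n <= N)%N -> Ipiece x n y ->
  Iint x N (Linv x N n y).
Proof.
move=> /andP[n0 nN] ny.
have xn : 0 < x n - x n.-1 by rewrite subr_gt0 xlt// prednK// leqnn.
have xN : 0 < x N - x 0%N by rewrite subr_gt0 xlt// leqnn andbT (leq_trans n0).
have {ny} /andP[ny yn] : x n.-1 <= y <= x n.
  move: ny; rewrite /Ipiece; case: ifPn => [/eqP->|_]; rewrite /= in_itv//=.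
  by move=> /andP[/ltW -> ->].
rewrite /Iint /Linv /= in_itv/=; apply/andP; split.
  by rewrite lerDl mulr_ge0 ?subr_ge0// divr_ge0// ltW.
rewrite -lerBrDl mulrA ler_pdivrMr// mulrC ler_wpM2l ?lerB//.
exact: ltW.
Qed.

(** This is the map [tau] of the overview. The indicator sum, of the same shape as in [Top], makes
    it measurable on the whole line; it is 0 off the pieces. *)
Definition Linv_map (y : R) : R :=
  \sum_(1 <= n < N.+1) \1_(Ipiece x n) y * Linv x N n y.

Lemma Linv_mapE (y : R) n : (1 <= n <= N)%N -> Ipiece x n y ->
  Linv_map y = Linv x N n y.
Proof. exact: sum_Ipiece. Qed.

Lemma Linv_map_Iint (y : R) : Iint x N y -> Iint x N (Linv_map y).
Proof.
by move=> /Ipiece_cover[n nN ny]; rewrite (Linv_mapE nN ny); exact: Linv_Ipiece.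
Qed.

Lemma measurable_Linv n : measurable_fun setT (Linv x N n).
Proof. exact: measurable_affine. Qed.

Lemma measurable_Linv_map : measurable_fun setT Linv_map.
Proof.
apply: measurable_sum => n; apply: measurable_funM; last exact: measurable_Linv.
by apply: measurable_indic; exact: measurable_Ipiece.
Qed.

(** * Invariance of the measure of [I] under the expanding map *)

Let J k : set R := `]x 0%N, x k]%classic.

(** Discarding the null point [x 0] replaces the closed first piece by a half-open one, so that all
    branches can be treated alike. *)
Lemma muI_itv_oc (D : set R) : measurable D ->
  muI x N D = lebesgue_measure (D `&` J N).
Proof.
move=> mD; rewrite /muI /mrestr.
have mDJ : measurable (D `&` J N) by apply: measurableI => //; exact: measurable_itv.
have m0 : measurable (D `&` [set x 0%N]) by exact: measurableI.
have D0 : lebesgue_measure (D `&` [set x 0%N]) = 0%E.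
  apply: (@subset_measure0 _ _ _ (@lebesgue_measure R) _ [set x 0%N]) => //.
  exact: lebesgue_measure_set1.
have -> : D `&` Iint x N = (D `&` J N) `|` (D `&` [set x 0%N]).
  rewrite -setIUr; congr (_ `&` _).
  apply/seteqP; split => y; rewrite /Iint /J /= !in_itv/=.
    move=> /andP[y0 ->]; rewrite andbT; move: y0.
    by rewrite le_eqVlt => /orP[/eqP->|->]; [right|left].
  move=> [/andP[/ltW -> ->]//|->]; rewrite lexx/= ltW// xlt// leqnn andbT.
  exact: leq_trans N2.
by rewrite measureU0.
Qed.

(** [Linv x N k.+1] is an increasing affine bijection of []x k, x k.+1]] onto [J N], so landing in
    [J N] already forces the point into this branch. The right-hand side is a full affine preimage,
    whose measure is known. *)
Lemma Linv_map_branch (B : set R) k : (k < N)%N ->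
  Linv_map @^-1` B `&` `]x k, x k.+1]%classic = Linv x N k.+1 @^-1` (B `&` J N).
Proof.
move=> kN; have kN' : (1 <= k.+1 <= N)%N by [].
have xk : 0 < x k.+1 - x k by rewrite subr_gt0 xlt// ltnSn.
have xN : 0 < x N - x 0%N by rewrite subr_gt0 xlt// leqnn andbT (leq_trans _ kN).
have JE y : J N (Linv x N k.+1 y) = (x k < y <= x k.+1).
  rewrite /J /Linv /= in_itv/= ltrDl pmulr_lgt0 ?divr_gt0// subr_gt0.
  congr (_ && _ : Prop).
  rewrite -lerBrDl mulrA ler_pdivrMr// mulrC ler_pM2l//.
  by rewrite lerD2r.
apply/seteqP; split => y /=.
  rewrite in_itv/= => -[By yk]; rewrite JE yk.
  have yp : Ipiece x k.+1 y.
    rewrite /Ipiece; case: ifPn => [/eqP[k0]|_] /=; rewrite in_itv//=.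
    by move: yk; rewrite k0 => /andP[/ltW -> ->].
  by rewrite -(Linv_mapE kN' yp).
move=> [By]; rewrite JE in_itv/= => yk; split => //.
have yp : Ipiece x k.+1 y.
  rewrite /Ipiece; case: ifPn => [/eqP[k0]|_] /=; rewrite in_itv//=.
  by move: yk; rewrite k0 => /andP[/ltW -> ->].
by rewrite (Linv_mapE kN' yp).
Qed.

Lemma muI_Linv_map (B : set R) : measurable B ->
  muI x N (Linv_map @^-1` B) = muI x N B.
Proof.
move=> mB; have mT : measurable (Linv_map @^-1` B).
  by rewrite -[_ @^-1` _]setTI; exact: measurable_Linv_map.
have mJ k : measurable (J k) by exact: measurable_itv.
have xN : 0 < x N - x 0%N by rewrite subr_gt0 xlt// leqnn andbT (leq_trans _ N2).
rewrite !muI_itv_oc//.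
(* Induction on the number of branches: the branch over []x k, x k.+1]] adds its relative length,
   the ratios telescope, and [k = N] gives 1. *)
have step k : (k <= N)%N -> lebesgue_measure (Linv_map @^-1` B `&` J k) =
    (((x k - x 0%N) / (x N - x 0%N))%:E * lebesgue_measure (B `&` J N))%E.
  elim: k => [|k IH] kN.
    by rewrite subrr mul0r mul0e /J set_itvxx setI0 measure0.
  have x0k : x 0%N <= x k.
    by case: k kN {IH} => // k kN; rewrite ltW// xlt//= ltnW.
  have xk : 0 < x k.+1 - x k by rewrite subr_gt0 xlt// ltnSn.
  have -> : J k.+1 = J k `|` `]x k, x k.+1]%classic.
    rewrite /J -itv_bndbnd_setU//.
    by rewrite bnd_simp ltW// -subr_gt0.
  have mk : measurable (Linv_map @^-1` B `&` J k) by exact: measurableI.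
  have mk1 : measurable (Linv_map @^-1` B `&` `]x k, x k.+1]%classic).
    by apply: measurableI => //; exact: measurable_itv.
  rewrite setIUr measureU//; last first.
    apply/seteqP; split => y //= [[_ +] [_ +]]; rewrite /J /= !in_itv/=.
    by move=> /andP[_ yk] /andP[+ _]; rewrite ltNge yk.
  have Ek : lebesgue_measure (Linv_map @^-1` B `&` `]x k, x k.+1]%classic) =
      (((x N - x 0%N) / (x k.+1 - x k))^-1%:E * lebesgue_measure (B `&` J N))%E.
    rewrite Linv_map_branch//; apply: lebesgue_measure_affine_preimage.
      by rewrite divr_gt0.
    exact: measurableI.
  rewrite [X in (X + _)%E](IH (ltnW kN)) [X in (_ + X)%E]Ek.
  rewrite -ge0_muleDl ?lee_fin; last 2 first.
  - by rewrite divr_ge0 ?subr_ge0// ltW// -subr_gt0.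
  - by rewrite invr_ge0 divr_ge0 ?subr_ge0// ltW// -subr_gt0.
  congr (_ * _)%E; rewrite -EFinD; congr EFin => /=.
  by field; rewrite !gt_eqF.
by rewrite step// divff ?mul1e// gt_eqF.
Qed.

(* [{ae muI x N, _}] is stated for the bare set function, so that the library
   instance for measures is not found. *)
#[local] Instance ae_muI_filter : Filter (almost_everywhere (muI x N)).
Proof. exact: (ae_filter_ringOfSetsType (muI x N)). Qed.

(** * The operator [T] on [I], its coefficient, and representatives in [L^p(I)] *)

Lemma ae_Iint : {ae muI x N, forall y, Iint x N y}.
Proof.
exists (~` Iint x N); split => //.
  by apply: measurableC; exact: Iint_measurable.
by rewrite /muI /mrestr setICl measure0.
Qed.

(** This is the coefficient [A] of the overview. Each [alpha n] is measurable only on [I]; extending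
    it by 0 makes [A] globally measurable and changes nothing on [I_n], where [Linv x N n] takes
    values in [I]. *)
Definition alpha_map (alpha : nat -> R -> R) (y : R) : R :=
  \sum_(1 <= n < N.+1) \1_(Ipiece x n) y * (alpha n \_ (Iint x N)) (Linv x N n y).

Lemma alpha_mapE (alpha : nat -> R -> R) (y : R) n :
  (1 <= n <= N)%N -> Ipiece x n y -> alpha_map alpha y = alpha n (Linv x N n y).
Proof.
move=> nN ny; rewrite /alpha_map.
rewrite (sum_Ipiece (fun m => (alpha m \_ (Iint x N)) (Linv x N m y)) nN ny).
by rewrite patchT// inE; exact: Linv_Ipiece.
Qed.

Lemma TopE (alpha : nat -> R -> R) (f b g : R -> R) (y : R) : Iint x N y ->
  Top x N alpha f b g y =
  f y + alpha_map alpha y * (g (Linv_map y) - b (Linv_map y)).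
Proof.
move=> /Ipiece_cover[n nN ny]; rewrite /Top (alpha_mapE alpha nN ny) (Linv_mapE nN ny).
congr (_ + _); exact: (sum_Ipiece (fun m => alpha m (Linv x N m y) *
  (g (Linv x N m y) - b (Linv x N m y))) nN ny).
Qed.

Lemma measurable_alpha_map (alpha : nat -> R -> R) :
  (forall n, (1 <= n <= N)%N -> measurable_fun (Iint x N) (alpha n)) ->
  measurable_fun setT (alpha_map alpha).
Proof.
move=> malpha.
(* [measurable_sum] asks for measurability at every index, so the summand is set to 0 outside the
   range where [alpha n] is controlled. *)
have -> : alpha_map alpha = fun y => \sum_(1 <= n < N.+1) (if (1 <= n <= N)%N then
    \1_(Ipiece x n) y * (alpha n \_ (Iint x N)) (Linv x N n y) else 0).
  apply/funext => y; rewrite /alpha_map big_nat [RHS]big_nat.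
  by apply: eq_bigr => n nN; rewrite -ltnS nN.
apply: measurable_sum => n /=; case: (boolP (1 <= n <= N)%N) => [nN|_]; last exact: measurable_cst.
apply: measurable_funM.
  by apply: measurable_indic; exact: measurable_Ipiece.
have mn : measurable_fun setT (alpha n \_ (Iint x N)).
  by apply/(measurable_restrictT _ (Iint_measurable x N)); exact: malpha.
exact: (measurableT_comp mn (measurable_Linv n)).
Qed.

(** The bound on the maximum of all [|alpha m|] holds at almost every point, hence by invariance at
    [Linv_map y] for almost every [y]; there [|alpha_map alpha y|] is one of the entries. *)
Lemma ae_alpha_map_le (alpha : nat -> R -> R) (q : R) :
  (Lambda x N alpha <= q%:E)%E ->
  {ae muI x N, forall y, `|alpha_map alpha y| <= q}.
Proof.
move=> /ess_supP aeq.
have := @ae_comp _ (measurableTypeR R) R (muI x N) _ measurable_Linv_map muI_Linv_map _ aeq.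
apply: filterS2 ae_Iint => y /Ipiece_cover[n nN ny]; rewrite lee_fin.
rewrite (Linv_mapE nN ny) (alpha_mapE alpha nN ny); apply: le_trans.
apply: (@le_bigmax_seq _ _ _ _ _ n _ (fun m => `|alpha m (Linv x N n y)|)) => //.
by rewrite mem_index_iota.
Qed.

Lemma muI_setT : muI x N setT \is a fin_num.
Proof.
rewrite /muI /mrestr setTI /Iint lebesgue_measure_itv/=.
by case: ifP => // _; rewrite -EFinD.
Qed.

(* No measurability is assumed: the representatives of an element of [L^p(I)]
   are arbitrary, possibly non-measurable, outside [I]. *)
Lemma finite_norm_le (p : \bar R) (f g : R -> R) : (1 <= p)%E ->
  (forall y, `|f y| <= `|g y|) ->
  finite_norm (muI x N) p g -> finite_norm (muI x N) p f.
Proof.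
rewrite /finite_norm => p1 fg; apply: le_lt_trans; rewrite unlock.
case: p p1 => [p|_|//].
  rewrite lee_fin => p1; have p0 : 0 < p by exact: lt_le_trans p1.
  apply: gt0_ler_poweR; rewrite ?invr_ge0 ?(ltW p0)//.
  - by rewrite in_itv/= leey andbT integral_ge0.
  - by rewrite in_itv/= leey andbT integral_ge0.
  (* As a supremum over the simple functions below the integrand, the integral is monotone without
     measurability. *)
  rewrite !ge0_integralTE; last 2 first.
  - by move=> y; exact: poweR_ge0.
  - by move=> y; exact: poweR_ge0.
  apply: ub_ereal_sup => _ [h hf <-]; apply: ereal_sup_ubound; exists h => // y.
  apply: le_trans (hf y) _; rewrite /= lee_fin ge0_ler_powR ?nnegrE//.
  exact: ltW.
case: ifPn => // _; apply: le_ess_sup; apply: aeW => y /=.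
by rewrite lee_fin.
Qed.

(** Cutting off outside [I] gives a representative measurable on the whole line, to which the
    results on [Lfun] apply. *)
Lemma inLp_restrict (p : \bar R) (f : R -> R) : (1 <= p)%E ->
  inLp x N p f -> f \_ (Iint x N) \in Lfun (muI x N) p.
Proof.
move=> p1 [mf fp]; apply/andP; rewrite !inE/=; split.
  exact/(measurable_restrictT _ (Iint_measurable x N)).
apply: finite_norm_le fp => // y.
by rewrite patchE; case: ifPn => // _; rewrite normr0.
Qed.

Lemma Lfun_inLp (p : \bar R) (f : R -> R) :
  f \in Lfun (muI x N) p -> inLp x N p f.
Proof.
by move=> /andP[]; rewrite !inE/= => mf fp; split => //; exact: measurable_funTS.
Qed.

(** * Fixed points of [T], and bijectivity of [I - P_0^1] *)

Section fixpoints.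
Context (alpha : nat -> R -> R) (p : \bar R) (r : R).
Hypothesis p1 : (1 <= p)%E.
Hypothesis malpha :
  forall n, (1 <= n <= N)%N -> measurable_fun (Iint x N) (alpha n).
Hypothesis r01 : 0 < r < 1.
Hypothesis alpha_r : (Lambda x N alpha <= (r ^+ 2)%:E)%E.

Let A := alpha_map alpha.
Let tau := Linv_map.

Let A_le : {ae muI x N, forall y, `|A y| <= r ^+ 2}.
Proof. exact: ae_alpha_map_le. Qed.

Let mA : measurable_fun setT A.
Proof. exact: measurable_alpha_map. Qed.

Let patch_Iint (f : R -> R) y : Iint x N y -> (f \_ (Iint x N)) y = f y.
Proof. by move=> Iy; rewrite patchT// inE. Qed.

Lemma Lfun_alpha_shift (f : R -> R) : f \in Lfun (muI x N) p ->
  (fun y => A y * f (tau y)) \in Lfun (muI x N) p.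
Proof.
move=> fp; have [r0 r1] := andP r01.
have ftau := @Lfun_comp _ (measurableTypeR R) R (muI x N) _
  measurable_Linv_map muI_Linv_map _ _ p1 fp.
have Af : {ae muI x N, forall y, `|A y * f (tau y)| <= `|f (tau y)|}.
  apply: filterS A_le => y Ay; rewrite normrM ler_piMl//.
  by rewrite (le_trans Ay)// exprn_ile1// ltW.
apply: (Lfun_le p1 _ ftau Af).
by apply: measurable_funM => //; exact: Lfun_measurable ftau.
Qed.

Lemma is_fixT_exists (b : R -> R) : inLp x N p b ->
  exists g, is_fixT x N p alpha (fun=> 0) b g.
Proof.
(* Expanding [g = A . ((g - b) o tau)] gives an affine equation with source term
   [- A . (b o tau)]. *)
move=> bp; have fp := Lfun_scalel (-1) p1 (Lfun_alpha_shift (inLp_restrict p1 bp)).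
have [h hp hE] := @Lfun_affine_fixpoint _ (measurableTypeR R) R (muI x N) _
  measurable_Linv_map muI_Linv_map _ _ _ _ p1 r01 mA A_le fp.
exists h; split; first exact: Lfun_inLp.
apply: filterS2 ae_Iint hE => y Iy ->.
rewrite TopE// patch_Iint; last exact: Linv_map_Iint.
by rewrite /A /tau; ring.
Qed.

(** In the difference of two fixed points [b] cancels, leaving [u = A . (u o tau)] with
    [|A| <= r ^+ 2 < 1]. *)
Lemma is_fixT_unique (b g1 g2 : R -> R) :
  is_fixT x N p alpha (fun=> 0) b g1 -> is_fixT x N p alpha (fun=> 0) b g2 ->
  aeqI x N g1 g2.
Proof.
move=> [/(inLp_restrict p1) g1p g1E] [/(inLp_restrict p1) g2p g2E].
have [_ /(_ (-1) _ _ g2p g1p) up] := Lfun_submod_closed (muI x N) p1.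
have [r0 r1] := andP r01.
have r2 : 0 <= r ^+ 2 < 1 by rewrite exprn_ge0 ?exprn_ilt1// ltW.
have := @Lfun_linear_fixpoint_eq0 _ (measurableTypeR R) R (muI x N) _
  measurable_Linv_map muI_Linv_map _ _ _ p1 muI_setT r2 up.
have ae12 : {ae muI x N, forall y, g1 y - g2 y = A y * (g1 (tau y) - g2 (tau y))}.
  apply: filterS3 ae_Iint g1E g2E => y Iy.
  by rewrite !TopE// => <- <-; rewrite /A /tau; ring.
have uE y : Iint x N y ->
    (-1 *: (g2 \_ (Iint x N) : R -> R) + g1 \_ (Iint x N)) y = g1 y - g2 y.
  move=> Iy; rewrite -[LHS]/(-1 * (g2 \_ (Iint x N)) y + (g1 \_ (Iint x N)) y).
  by rewrite !patch_Iint//; ring.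
move=> /(_ _)/(@filterS2 _ _ ae_muI_filter _ _ _ _ ae_Iint); apply => [y Iy|].
  by rewrite uE// => /subr0_eq.
apply: filterS3 ae_Iint ae12 A_le => y Iy E Ay.
rewrite !uE//; last exact: Linv_map_Iint.
by rewrite E normrM ler_wpM2r.
Qed.

(** Existence rules out the default value 0 in [starT]. *)
Lemma P01_fix (b : R -> R) : inLp x N p b ->
  is_fixT x N p alpha (fun=> 0) b (P01 x N p alpha b).
Proof.
move=> bp; rewrite /P01 /starT; case: pselect => [ex|]; first exact: projT2 (cid ex).
by move=> /(_ (is_fixT_exists bp)).
Qed.

(** The fixed point equation recovers [P01 b] from [b - P01 b] alone, so equal differences give
    equal fixed points, and then equal [b]. *)
Lemma id_sub_P01_injective (b1 b2 : R -> R) : inLp x N p b1 -> inLp x N p b2 ->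
  aeqI x N (b1 \- P01 x N p alpha b1) (b2 \- P01 x N p alpha b2) ->
  aeqI x N b1 b2.
Proof.
move=> /P01_fix[_ g1E] /P01_fix[_ g2E] b12.
have b12t := @ae_comp _ (measurableTypeR R) R (muI x N) _
  measurable_Linv_map muI_Linv_map _ b12.
have g12 : aeqI x N (P01 x N p alpha b1) (P01 x N p alpha b2).
  apply: filterS2 (filterI ae_Iint b12t) (filterI g1E g2E) => y [Iy /= b12y] [<- <-].
  rewrite !TopE//; congr (_ + _ * _).
  by rewrite -opprB b12y opprB.
by apply: filterS2 b12 g12 => y /= b12y g12y; move: b12y; rewrite g12y => /addIr.
Qed.

(** The preimage is [b = g - S g]. The candidate [s = - S g] for [P01 b] satisfies [s - b = - g],
    hence [T s = S (s - b) = s]; uniqueness gives [P01 b = s] and [b - s = g]. *)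
Lemma id_sub_P01_surjective (g : R -> R) : inLp x N p g ->
  exists b, inLp x N p b /\ aeqI x N g (b \- P01 x N p alpha b).
Proof.
move=> gp; have g'p := inLp_restrict p1 gp.
pose g' := g \_ (Iint x N).
pose s y := -1 * (A y * g' (tau y)).
have sp : s \in Lfun (muI x N) p by exact: Lfun_scalel (Lfun_alpha_shift g'p).
have bp : g' \+ s \in Lfun (muI x N) p.
  by have [_ /(_ 1 _ _ g'p sp)] := Lfun_submod_closed (muI x N) p1; rewrite scale1r.
exists (g' \+ s); split; first exact: Lfun_inLp.
have sfix : is_fixT x N p alpha (fun=> 0) (g' \+ s) s.
  split; first exact: Lfun_inLp.
  apply: filterS ae_Iint => y Iy; rewrite TopE//= [in RHS]/s.
  by rewrite /A /tau; ring.
have := is_fixT_unique (P01_fix (Lfun_inLp bp)) sfix.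
apply: filterS2 ae_Iint => y Iy /= ->.
by rewrite addrK /g' patch_Iint.
Qed.

End fixpoints.

End partition.

(** Writing the contraction bound as a square supplies the two factors [r ^+ k] used for the Neumann
    series. *)
Lemma lt1_le_sqr (R : realType) (l : \bar R) : (l < 1)%E ->
  exists2 r : R, 0 < r < 1 & (l <= (r ^+ 2)%:E)%E.
Proof.
move=> l1; have [q /andP[q0 q1] lq] : exists2 q : R, 0 < q < 1 & (l <= q%:E)%E.
  (* The maximum with [2^-1] keeps the bound positive even if [l] is nonpositive or [-oo]. *)
  exists (Num.max 2^-1 (fine l)).
    rewrite lt_max invr_gt0 ltr0n/= gt_max invf_lt1// ltr1n/=.
    by case: l l1 => [l| |]//=; rewrite ?lte_fin.
  case: l l1 => [l| |]//= _; last by rewrite leNye.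
  by rewrite lee_fin le_max lexx orbT.
exists (Num.sqrt q); last by rewrite sqr_sqrtr// ltW.
by rewrite sqrtr_gt0 q0/= -[ltRHS]sqrtr1 ltr_sqrt.
Qed.

Theorem theorem6p6 (R : realType) (N : nat) (x : nat -> R)
    (alpha : nat -> R -> R) (p : \bar R) :
  (2 <= N)%N ->
  (forall i j : nat, (i < j <= N)%N -> x i < x j) ->
  (1 <= p)%E ->
  (forall n : nat, (1 <= n <= N)%N ->
     measurable_fun (Iint x N) (alpha n) /\ finite_norm (muI x N) +oo%E (alpha n)) ->
  (Lambda x N alpha < 1)%E ->
  (* injectivity of I - P_0^1 on E *)
  (forall b1 b2 : R -> R, inLp x N p b1 -> inLp x N p b2 ->
     aeqI x N (b1 \- P01 x N p alpha b1) (b2 \- P01 x N p alpha b2) ->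
     aeqI x N b1 b2) /\
  (* closed range: limits in E of elements of the range lie in the range *)
  (forall (h : nat -> R -> R) (bs : nat -> R -> R) (g : R -> R),
     (forall k, inLp x N p (bs k)) ->
     (forall k, aeqI x N (h k) (bs k \- P01 x N p alpha (bs k))) ->
     (forall k, inLp x N p (h k)) ->
     inLp x N p g ->
     (fun k => Lnorm (muI x N) p (EFin \o (h k \- g))) @ \oo --> 0%E ->
     exists b, inLp x N p b /\ aeqI x N g (b \- P01 x N p alpha b)).
Proof.
move=> N2 xlt p1 malpha /lt1_le_sqr[r r01 Lr].
have ma n : (1 <= n <= N)%N -> measurable_fun (Iint x N) (alpha n).
  by move=> /malpha[].
split; first exact: (id_sub_P01_injective N2 xlt p1 ma r01 Lr).
(* The range is all of [E], so the limit [g] lies in it by surjectivity. *)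
move=> _ _ g _ _ _ gp _.
exact: (id_sub_P01_surjective N2 xlt p1 ma r01 Lr).
Qed.
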